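(* There is a constant $p_0=0.312\ldots$ (i.e. $0.312\le p_0<0.313$) such that for all $0<p<p_0$, $$V_2(p)\ \ge\ U_3(p)\ >\ \max\bigl(U_1(p),U_2(p)\bigr),$$ where $$U_3(p)=\frac{5p-20p^{2}+51p^{3}-82p^{4}+85p^{5}-52p^{6}+10p^{7}+10p^{8}-7p^{9}}{10-45p+120p^{2}-210p^{3}+250p^{4}-200p^{5}+100p^{6}-25p^{7}}.$$
   Context: Biased two-player Levine hat game: for $p\in\,]0,1[$, players A and B have infinite stacks $U=(U^{(k)})_{k\ge1}$ and $V=(V^{(k)})_{k\ge1}$, all entries being independent Bernoulli$(p)$ variables ($1$ = black, with probability $p$; $0$ = white). Each player sees only the other player's stack and names an index in $\{1,2,3,\dots\}$ using a measurable strategy $K:\{0,1\}^{\mathbb N^*}\to\mathbb N^*$. If A uses $K_1$ and B uses $K_2$, they win if and only if $U^{(K_1(V))}=1$ and $V^{(K_2(U))}=1$. $V_2(p)$ is the supremum of the winning probability over all pairs of strategies. $$U_1(p)=\frac{p+p^2+p^3+3p^4-3p^5+p^6}{2+p+p^2+p^3-p^4},\qquad U_2(p)=\frac{p+5p^2-10p^3+10p^4-5p^5+p^6}{4-2p-2p^2+3p^3-p^4}.$$ *)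

(* Defs.v *)
From HB Require Import structures.
From mathcomp Require Import all_boot all_order all_algebra finmap.
From mathcomp Require Import all_classical all_reals all_analysis.
From mathcomp Require Import measurable_realfun.

Set Implicit Arguments.
Unset Strict Implicit.
Unset Printing Implicit Defensive.

Import Order.TTheory GRing.Theory Num.Theory.
Import numFieldNormedType.Exports.

Local Open Scope classical_set_scope.
Local Open Scope ring_scope.

Definition mutually_independent (R : realType) (d d' : measure_display)
    (T : measurableType d) (T' : measurableType d') (P : probability T R)
    (I : choiceType) (X : I -> {RV P >-> T'}) : Prop :=
  forall (J : {fset I}) (B : I -> set T'), (forall i, measurable (B i)) ->
    (P (\bigcap_(i in [set` J]) (X i @^-1` B i)) =
     \prod_(i <- J) P (X i @^-1` B i))%E.

(* The product sigma-algebra on {0,1}^N, generated by the coordinate maps.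
   Levels are numbered from 0, and true is black. *)
Definition cylinders : set (set (nat -> bool)) :=
  \bigcup_k preimage_set_system [set: nat -> bool] (fun w => w k) measurable.

Notation stack := (g_sigma_algebraType cylinders).

Notation strategy := {mfun stack >-> nat}.

Section levine_game.
Context (R : realType) (d : measure_display) (T : measurableType d).
Variable P : probability T R.
Implicit Types U V : nat -> {RV P >-> bool}.

Definition entries U V (i : nat + nat) : {RV P >-> bool} :=
  match i with inl k => U k | inr k => V k end.

Definition levine_stacks (p : R) U V : Prop :=
  (forall i A, distribution P (entries U V i) A = bernoulli_prob p A) /\
  mutually_independent (entries U V).

(* Player A applies K1 to the stack of B, and player B applies K2 to the stack
   of A. *)
Definition win U V (K1 K2 : strategy) : set T :=
  [set t | U (K1 (fun k => V k t)) t /\ V (K2 (fun k => U k t)) t].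

(* The hypothesis levine_stacks p U V fixes the joint law of the stacks, so
   under it this value depends on p only. *)
Definition V2 U V : \bar R :=
  ereal_sup [set P (win U V K.1 K.2) | K in [set: strategy * strategy]].

End levine_game.

Definition U1 (R : realType) (p : R) : R :=
  (p + p ^+ 2 + p ^+ 3 + 3 * p ^+ 4 - 3 * p ^+ 5 + p ^+ 6) /
  (2 + p + p ^+ 2 + p ^+ 3 - p ^+ 4).

Definition U2 (R : realType) (p : R) : R :=
  (p + 5 * p ^+ 2 - 10 * p ^+ 3 + 10 * p ^+ 4 - 5 * p ^+ 5 + p ^+ 6) /
  (4 - 2 * p - 2 * p ^+ 2 + 3 * p ^+ 3 - p ^+ 4).

Definition U3 (R : realType) (p : R) : R :=
  (5 * p - 20 * p ^+ 2 + 51 * p ^+ 3 - 82 * p ^+ 4 + 85 * p ^+ 5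
    - 52 * p ^+ 6 + 10 * p ^+ 7 + 10 * p ^+ 8 - 7 * p ^+ 9) /
  (10 - 45 * p + 120 * p ^+ 2 - 210 * p ^+ 3 + 250 * p ^+ 4
    - 200 * p ^+ 5 + 100 * p ^+ 6 - 25 * p ^+ 7).

(* Stacks satisfying levine_stacks exist on [0, 1] with the uniform probability:
   digit k x tells whether x lies in [0, p[ (black) or in [p, 1[ after k steps,
   each of which stretches the interval containing x onto [0, 1[. *)
Section existence.
Context (R : realType) (p : R).
Hypothesis p01 : 0 < p < 1.

Let P : probability _ R := uniform_prob (@ltr01 R).

Definition rescale (x : R) : R := if x < p then x / p else (x - p) / (1 - p).

Definition digit (k : nat) (x : R) : bool := iter k rescale x < p.

Lemma measurable_digit k : measurable_fun [set: R] (digit k).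
Proof.
apply: measurable_fun_ltr => //.
elim: k => [|k IHk]; first exact: measurable_id.
apply: (measurableT_comp (f := rescale) (g := iter k rescale)) => //.
apply: measurable_fun_ifT => /=.
- exact: measurable_fun_ltr.
- by apply: measurable_funM.
- by apply: measurable_funM => //; exact: measurable_funB.
Qed.

(* cell s x states that x is in [0, 1[ and that its first digits are s. *)
Fixpoint cell (s : seq bool) (x : R) : bool :=
  if s is b :: s' then (digit 0 x == b) && cell s' (rescale x) else 0 <= x < 1.

Let weight (s : seq bool) : R := \prod_(b <- s) bernoulli_pmf p b.

Lemma weight_gt0 s : 0 < weight s.
Proof.
by case/andP: p01 => p0 p1; apply: prodr_gt0 => -[] _ //=; rewrite subr_gt0.
Qed.

Lemma cell01 s x : cell s x -> 0 <= x < 1.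
Proof.
case/andP: (p01) => p0 p1; have q0 : 0 < 1 - p by rewrite subr_gt0.
elim: s x => [|c t IHt] //= x /andP[_ /IHt].
rewrite /rescale; case: ltP => xp.
  rewrite ler_pdivlMr// mul0r => /andP[-> _]/=.
  exact: lt_trans xp p1.
by rewrite ltr_pdivrMr// mul1r ltrD2r (le_trans (ltW p0) xp) => /andP[].
Qed.

Lemma cell_itv s : exists a, cell s =1 (fun x => a <= x < a + weight s).
Proof.
case/andP: (p01) => p0 p1; have q0 : 0 < 1 - p by rewrite subr_gt0.
elim: s => [|b s [a cella]].
  by exists 0 => x; rewrite /weight big_nil add0r.
have cell01 := @cell01 s.
rewrite /weight big_cons -/(weight s); case: b => /=.
  exists (p * a) => x /=; rewrite /digit/= eqb_id.
  transitivity (cell s (x / p)).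
    rewrite /rescale; case: ltP => //= px; apply/esym/negbTE/negP => /cell01.
    by rewrite ltr_pdivrMr// mul1r ltNge px andbF.
  by rewrite cella ler_pdivlMr// ltr_pdivrMr// mulrDl [a * p]mulrC [_ * p]mulrC.
exists (p + (1 - p) * a) => x /=; rewrite /digit/= eqbF_neg -leNgt.
transitivity (cell s ((x - p) / (1 - p))).
  rewrite /rescale; case: ltP => //= px; apply/esym/negbTE/negP => /cell01.
  by rewrite ler_pdivlMr// mul0r subr_ge0 leNgt px.
rewrite cella ler_pdivlMr// ltr_pdivrMr// lerBrDl ltrBlDl.
by rewrite mulrDl [a * _]mulrC [_ * (1 - p)]mulrC addrA.
Qed.

Lemma cell_rcons s b x :
  cell (rcons s b) x = cell s x && (digit (size s) x == b).
Proof.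
elim: s x => [|c s IHs] x /=; last by rewrite IHs andbA /digit iterSr.
rewrite andbC; case/andP: (p01) => p0 p1; congr (_ && _).
rewrite /rescale; case: ltP => xp.
  rewrite ler_pdivlMr// ltr_pdivrMr// mul0r mul1r xp andbT.
  by rewrite (lt_trans xp p1) andbT.
have q0 : 0 < 1 - p by rewrite subr_gt0.
rewrite ler_pdivlMr// ltr_pdivrMr// mul0r mul1r ltrD2r subr_ge0 xp.
by rewrite (le_trans (ltW p0) xp).
Qed.

Lemma measurable_cell s : measurable (cell s : set (measurableTypeR R)).
Proof.
have [a sa] := cell_itv s.
rewrite (_ : (cell s : set _) = [set` `[a, a + weight s[]); first exact: measurable_itv.
by apply/seteqP; split=> x /=; rewrite in_itv/= -sa.
Qed.

Lemma P_cell s : P (cell s : set _) = (weight s)%:E.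
Proof.
have [a sa] := cell_itv s.
rewrite /P /= /uniform_prob (eq_integral (fun=> 1%E)); last first.
  move=> x; rewrite inE /= => /cell01/andP[x0 x1].
  by rewrite /uniform_pdf x0 (ltW x1) subr0 invr1.
rewrite integral_cst//=; last exact: measurable_cell.
rewrite mul1e (_ : (cell s : set _) = [set` `[a, a + weight s[]); last first.
  by apply/seteqP; split=> x /=; rewrite in_itv/= -sa.
by rewrite lebesgue_measure_itv/= lte_fin ltrDl weight_gt0 -EFinD addrAC subrr add0r.
Qed.

Fixpoint fits (C : seq (set bool)) (k : nat) (x : R) : Prop :=
  if C is A :: C' then A (digit k x) /\ fits C' k.+1 x else True.

Let bern (A : set bool) : R :=
  (if true \in A then p else 0) + (if false \in A then 1 - p else 0).

Lemma measurable_fits C k :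
  measurable (fits C k : set (measurableTypeR R)).
Proof.
elim: C k => [|A C IHC] k /=; first by rewrite [X in measurable X](_ : _ = setT)//; apply/seteqP.
rewrite [X in measurable X](_ : _ = (digit k @^-1` A) `&` fits C k.+1)//.
apply: measurableI => //.
by rewrite -[X in measurable X]setTI; exact: measurable_digit.
Qed.

Lemma P_fits C s :
  P ((cell s : set _) `&` fits C (size s)) =
  (weight s * \prod_(A <- C) bern A)%:E.
Proof.
elim: C s => [|A C IHC] s.
  rewrite big_nil mulr1 -P_cell; congr (P _).
  by apply/seteqP; split => x /= => [[]|].
have mC t n : measurable ((cell t : set (measurableTypeR R)) `&` fits C n).
  by apply: measurableI; [exact: measurable_cell|exact: measurable_fits].
pose F b := if b \in A then (cell (rcons s b) : set (measurableTypeR R)) `&` fits C (size s).+1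
  else set0.
have PF b : P (F b) = ((if b \in A then bernoulli_pmf p b else 0) *
    (weight s * \prod_(A <- C) bern A))%:E.
  rewrite /F; case: ifPn => bA; last by rewrite measure0 mul0r.
  have := IHC (rcons s b); rewrite size_rcons => ->.
  by rewrite /weight -cats1 big_cat big_seq1 /= -mulrA mulrCA.
rewrite (_ : _ `&` _ = F true `|` F false); last first.
  rewrite /F; apply/seteqP; split => x /=.
    move=> [sx [Ax Cx]].
    case E : (digit (size s) x) Ax => /mem_set Ax; [left|right];
      by rewrite Ax /= cell_rcons sx E.
  case=> [|]; case: ifPn => //; rewrite inE => Ab [/=];
    by rewrite cell_rcons => /andP[-> /eqP ->].
rewrite measureU/=.
- by rewrite !PF -EFinD -mulrDl big_cons mulrCA.
- by rewrite /F; case: ifP.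
- by rewrite /F; case: ifP.
rewrite /F; apply/seteqP; split => x //= [].
case: ifP => // _ [+ _]; case: ifP => // _ + [+ _] => /=.
by rewrite !cell_rcons => /andP[_ /eqP ->] /andP[].
Qed.

Lemma fitsP C k x :
  fits C k x <-> forall n, (n < size C)%N -> nth setT C n (digit (k + n) x).
Proof.
elim: C k => [|A C IHC] k /=; first by split.
rewrite IHC; split=> [[Ak kC] [|n] nC /=|kC]; first by rewrite addn0.
  by rewrite addnS -addSn; exact: kC.
split; first by rewrite -[k]addn0; exact: (kC 0%N).
by move=> n nC; rewrite addSn -addnS; exact: (kC n.+1).
Qed.

Lemma P_prefix (B : nat -> set bool) N :
  P [set x | forall n, (n < N)%N -> B n (digit n x)] =
  (\prod_(0 <= n < N) bern (B n))%:E.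
Proof.
have -> : [set x | forall n, (n < N)%N -> B n (digit n x)] =
    fits (mkseq B N) 0.
  apply/seteqP; split=> x /=; rewrite fitsP size_mkseq => Bx n nN.
    by rewrite nth_mkseq//; exact: Bx.
  by have := Bx _ nN; rewrite nth_mkseq.
have := P_fits (mkseq B N) [::].
rewrite /weight big_nil mul1r big_map /index_iota subn0 => <-.
have mf := measurable_fits (mkseq B N) 0.
have mc := measurable_cell [::].
have Pc : P (~` (cell [::] : set (measurableTypeR R))) = 0%E.
  by rewrite probability_setC// P_cell /weight big_nil subee.
rewrite setIC; apply/eqP; rewrite eq_le; apply/andP; split; last first.
  by apply: le_measure; rewrite ?inE//; exact: measurableI.
apply: (@le_trans _ _ (P ((fits (mkseq B N) 0 `&` (cell [::] : set _)) `|`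
    ~` (cell [::] : set (measurableTypeR R))))).
  apply: le_measure; rewrite ?inE//.
    by apply: measurableU; [exact: measurableI|exact: measurableC].
  by move=> x fx; case: (pselect (cell [::] x)) => cx; [left|right].
rewrite -[leRHS]adde0 -Pc; apply: measureU2; first exact: measurableI.
exact: measurableC.
Qed.

Lemma bernT : bern setT = 1.
Proof. by rewrite /bern !in_setT addrC subrK. Qed.

Lemma P_digit k A : P (digit k @^-1` A) = (bern A)%:E.
Proof.
have := P_prefix (fun n => if n == k then A else setT) k.+1.
rewrite big_nat_recr//= eqxx big_nat big1 ?mul1r => [<-|n /andP[_ nk]]; last first.
  by rewrite ltn_eqF// bernT.
congr (P _); apply/seteqP; split=> x /=.
  by move=> Ax n _; case: eqP => [->|].
by move/(_ k (ltnSn k)); rewrite eqxx.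
Qed.

Lemma bernE A : (bern A)%:E = bernoulli_prob p A.
Proof.
case/andP: p01 => p0 p1; rewrite bernoulli_probE ?(ltW p0) ?(ltW p1)//.
rewrite !diracE /bern EFinD.
by case: (true \in A); case: (false \in A); rewrite /= ?mule1 ?mule0.
Qed.

Let code (i : nat + nat) : nat :=
  match i with inl k => k.*2 | inr k => k.*2.+1 end.

Let decode (n : nat) : nat + nat := if odd n then inr n./2 else inl n./2.

Lemma codeK : cancel code decode.
Proof. by case=> k; rewrite /code /decode /= odd_double ?uphalf_double ?doubleK. Qed.

Lemma decodeK : cancel decode code.
Proof.
move=> n; rewrite /code /decode -[RHS](odd_double_half n).
by case: (odd n).
Qed.

Let rv k : {RV P >-> bool} :=
  @mfun_Sub _ _ (measurableTypeR R) bool _ (mem_set (@measurable_digit k)).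

Lemma digits_independent (J : {fset nat + nat}) (B : nat + nat -> set bool) :
  P (\bigcap_(i in [set` J]) digit (code i) @^-1` B i) =
  (\prod_(i <- J) bern (B i))%:E.
Proof.
pose N := (\max_(i <- J) code i).+1.
have JN i : i \in J -> (code i < N)%N.
  by move=> iJ; rewrite ltnS; exact: leq_bigmax_seq.
have := P_prefix (fun n => if decode n \in J then B (decode n) else setT) N.
rewrite (_ : [set x | _] =
    \bigcap_(i in [set` J]) digit (code i) @^-1` B i) => [->|].
  congr EFin; rewrite (eq_bigr (fun n => if decode n \in J
    then bern (B (decode n)) else 1)); last first.
    by move=> n _; case: ifP => //; rewrite bernT.
  rewrite -big_mkcond -big_filter -(big_map decode predT (fun i => bern (B i))).
  apply: perm_big; apply: uniq_perm => [||i].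
  - by rewrite (map_inj_uniq (can_inj decodeK)) filter_uniq// iota_uniq.
  - exact: fset_uniq.
  apply/mapP/idP => [[n + ->]|iJ]; first by rewrite mem_filter => /andP[].
  by exists (code i); rewrite ?codeK// mem_filter codeK iJ mem_index_iota JN.
apply/seteqP; split=> x /=.
  by move=> Bx i /= iJ; have := Bx _ (JN i iJ); rewrite codeK iJ.
move=> Bx n nN; case: ifPn => // nJ.
by have := Bx _ nJ; rewrite /= decodeK.
Qed.

Lemma levine_stacks_exist :
  exists (d : measure_display) (T : measurableType d) (P : probability T R)
    (U V : nat -> {RV P >-> bool}), levine_stacks p U V.
Proof.
exists _, _, P, (fun k => rv k.*2), (fun k => rv k.*2.+1).
have E i : (entries (fun k => rv k.*2) (fun k => rv k.*2.+1) i : _ -> bool) =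
  digit (code i) by case: i.
split=> [i A|J B mB].
  by rewrite /distribution /pushforward E P_digit bernE.
transitivity (P (\bigcap_(i in [set` J]) digit (code i) @^-1` B i)).
  by congr (P _); apply: eq_bigcapr => i _; rewrite E.
rewrite digits_independent -prodEFin; apply: eq_bigr => i _.
by rewrite E P_digit.
Qed.

End existence.

(* Main.v *)
Require Import Defs.
From HB Require Import structures.
From mathcomp Require Import all_boot all_order all_algebra finmap.
From mathcomp Require Import all_classical all_reals all_analysis.
From mathcomp Require Import ring lra.

(** Why the bound holds.  Both players cut the stacks into blocks of five
    cards.  A player skips the blocks of the visible stack that are of one
    colour and, in the first block that is not, names one of its five positions
    according to the rule [choose_card].

    Let r = p^5 + (1 - p)^5 be the probability that a block has one colour, and
    look at the first block of each stack.
    - If both have one colour, which happens with probability r^2 ([restart]),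
      both players move on and the game starts afresh.
    - If neither has, both players name a card of this first block, and the
      probability that both cards are black is a finite count over the 30 x 30
      pairs of two-coloured blocks ([tally_decided]).
    - If only the stack of A has one colour, A names a card of that block, which
      is black iff the block is, while B moves on and names a card of a later
      block of V, which nobody has looked at and is black with probability p.
      The other mixed case is symmetric.
    So the value x of this pair of strategies satisfies x = gain + r^2 x, where
    gain is the contribution of the last two cases, and U3 p is the solution of
    that equation ([U3_fixpoint]).

    Stopping after n blocks gives strategies that depend on finitely many cards
    only.  They are measurable, their winning probability is a finite sum
    ([P_finite_event]), it obeys the recursion of the value ([valueS]), and it
    converges to U3 p geometrically.  The supremum V2 is therefore at least
    U3 p.

    For the strict inequality, U3 - U1 and U3 - U2 are, up to positive
    denominators, p^3 (1 - p)^2 and p (1 - p)^2 times a polynomial that is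
    positive up to p = 0.312.  The first of these polynomials changes sign
    between 0.312 and 0.3125; p0 = 0.312 is admissible. *)

Set Implicit Arguments.
Unset Strict Implicit.
Unset Printing Implicit Defensive.

Import Order.TTheory GRing.Theory Num.Theory.
Import numFieldNormedType.Exports.
Local Open Scope classical_set_scope.
Local Open Scope ring_scope.

(** * Expectations over finite words of independent cards *)

(** A computable enumeration, so that the counts below can be evaluated. *)
Fixpoint words (n : nat) : seq (seq bool) :=
  if n is m.+1 then map (cons true) (words m) ++ map (cons false) (words m)
  else [:: [::]].

Lemma mem_words n s : (s \in words n) = (size s == n).
Proof.
elim: n s => [|n IHn] [|b s] //=; rewrite mem_cat.
  by apply/orP => -[] /mapP[].
rewrite eqSS -IHn; apply/orP/idP => [[] /mapP[t tn [_ ->]] //|sn].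
by case: b; [left|right]; apply: map_f.
Qed.

Lemma uniq_words n : uniq (words n).
Proof.
elim: n => //= n IHn; rewrite cat_uniq !map_inj_uniq ?IHn => [|s t []|s t []] //.
by rewrite andbT; apply/hasPn => _ /mapP[s _ ->]; apply/mapP => -[].
Qed.

Section expectation.
Variables (R : comNzRingType) (p : R).

Definition weight (s : seq bool) : R :=
  p ^+ count id s * (1 - p) ^+ count negb s.

Definition expect (n : nat) (F : seq bool -> R) : R :=
  \sum_(s <- words n) weight s * F s.

Lemma eq_expect n F G :
  (forall s, size s = n -> F s = G s) -> expect n F = expect n G.
Proof.
move=> FG; apply: eq_big_seq => s.
by rewrite mem_words => /eqP /FG ->.
Qed.

Lemma expectD n F G :
  expect n (fun s => F s + G s) = expect n F + expect n G.
Proof. by rewrite -big_split; apply: eq_bigr => s _; rewrite mulrDr. Qed.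

Lemma expectZ n a F : expect n (fun s => a * F s) = a * expect n F.
Proof. by rewrite big_distrr; apply: eq_bigr => s _; rewrite mulrCA. Qed.

Lemma expectS n F :
  expect n.+1 F = p * expect n (fun s => F (true :: s)) +
                  (1 - p) * expect n (fun s => F (false :: s)).
Proof.
rewrite /expect big_cat !big_map !big_distrr /weight /=.
by congr (_ + _); apply: eq_bigr => s _; rewrite exprS; ring.
Qed.

Lemma expect_cst n a : expect n (fun=> a) = a.
Proof.
elim: n => [|n IHn]; last by rewrite expectS !IHn; ring.
by rewrite /expect big_seq1 /weight !expr0 !mul1r.
Qed.

Lemma expect_cat m n F :
  expect (m + n) F = expect m (fun s => expect n (fun t => F (s ++ t))).
Proof.
elim: m F => [|m IHm] F; last by rewrite addSn !expectS !IHm.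
by rewrite [RHS]/expect big_seq1 /weight !expr0 !mul1r.
Qed.

Lemma expectC m n F :
  expect m (fun s => expect n (F s)) =
  expect n (fun t => expect m (fun s => F s t)).
Proof.
rewrite /expect; under eq_bigr do rewrite mulr_sumr.
rewrite exchange_big; apply: eq_bigr => t _; rewrite mulr_sumr.
by apply: eq_bigr => s _; rewrite mulrCA.
Qed.

Lemma expect_nth n i : (i < n)%N -> expect n (fun s => (nth false s i)%:R) = p.
Proof.
elim: n i => // n IHn [|i] i_lt; rewrite expectS /=.
  by rewrite !expect_cst mulr1 mulr0 addr0.
by rewrite !IHn//; ring.
Qed.

Definition tally (n : nat) (b : rel (seq bool)) (k : nat) : nat :=
  count (fun st => b st.1 st.2 && (count id st.1 + count id st.2 == k)%N)
    [seq (s, t) | s <- words n, t <- words n].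

Lemma sum_by_level (T : Type) (l : seq T) (b : pred T) (h : T -> nat) m
    (g : nat -> R) : all (fun x => h x < m)%N l ->
  \sum_(x <- l) g (h x) * (b x)%:R =
  \sum_(k < m) (count (fun x => b x && (h x == k)) l)%:R * g k.
Proof.
elim: l => [|x l IHl] /=; first by rewrite big_nil big1// => k _; rewrite mul0r.
move=> /andP[xm /IHl lm]; rewrite big_cons lm.
under [RHS]eq_bigr do rewrite natrD mulrDl.
rewrite big_split /=; congr (_ + _).
rewrite (bigD1 (Ordinal xm)) //= eqxx andbT big1 ?addr0 1?mulrC// => k kx.
by rewrite -(inj_eq val_inj) eq_sym /= in kx; rewrite (negbTE kx) andbF mul0r.
Qed.

(** A pair of words with k black cards in total has weight
    p^k (1 - p)^(2n - k), so the probability of an event depends only on the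
    number of its pairs at each level k.  These numbers are gathered in a
    sequence, which one evaluation can compute. *)
Lemma expect_tally n (b : rel (seq bool)) :
  expect n (fun s => expect n (fun t => (b s t)%:R)) =
  \sum_(k < (n + n).+1) (nth 0%N (mkseq (tally n b) (n + n).+1) k)%:R *
    (p ^+ k * (1 - p) ^+ (n + n - k)).
Proof.
have words_size s : s \in words n -> (count id s <= n)%N /\
    count negb s = (n - count id s)%N.
  rewrite mem_words => /eqP <-; split; first exact: count_size.
  by rewrite -(count_predC id s) addKn.
under [RHS]eq_bigr do rewrite nth_mkseq//.
rewrite -(@sum_by_level _ _ (fun st => b st.1 st.2)
  (fun st => count id st.1 + count id st.2)%N _
  (fun k => p ^+ k * (1 - p) ^+ (n + n - k))); last first.
  apply/allP => _ /allpairsP[st /= [/words_size[s1 _] /words_size[t1 _] ->]] /=.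
  by rewrite ltnS leq_add.
rewrite big_allpairs; apply: eq_big_seq => s /words_size[sn sE].
rewrite mulr_sumr; apply: eq_big_seq => t /words_size[tn tE] /=.
rewrite /weight sE tE mulrA; congr (_ * _).
have -> : (n + n - (count id s + count id t) =
  (n - count id s) + (n - count id t))%N by rewrite subnDA -addnBAC// -addnBA.
by rewrite !exprD; ring.
Qed.

End expectation.

Lemma expect_ge0 (R : realDomainType) (p : R) n (F : seq bool -> R) :
  0 <= p <= 1 -> (forall s, 0 <= F s) -> 0 <= expect p n F.
Proof.
move=> /andP[p0 p1] F0; apply: sumr_ge0 => s _.
by rewrite !mulr_ge0// exprn_ge0// subr_ge0.
Qed.

(** * The law of finitely many cards of the two stacks *)

Lemma measure_sum_over_values (R : realType) (d : measure_display)
    (T : measurableType d) (P : probability T R) (X : choiceType) (Z : T -> X)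
    (l : seq X) (b : pred X) :
  uniq l -> (forall t, Z t \in l) ->
  (forall x, measurable [set t | Z t = x]) ->
  P [set t | b (Z t)] = (\sum_(x <- l | b x) P [set t | Z t = x])%E.
Proof.
move=> ul Zl mZ.
rewrite -big_filter fsbig_seq ?filter_uniq// -measure_fin_bigcup//.
- congr (P _); apply/seteqP; split=> t /=.
    by move=> bt; exists (Z t) => //=; rewrite mem_filter bt Zl.
  by case=> x /=; rewrite mem_filter => /andP[bx _] ->.
- apply/trivIsetP => x y _ _ /eqP xy; apply/seteqP; split=> t //= [xt yt].
  by apply: xy; rewrite -xt -yt.
Qed.

Section stacks.
Context (R : realType) (d : measure_display) (T : measurableType d).
Variables (P : probability T R) (p : R) (U V : nat -> {RV P >-> bool}).
Hypotheses (p01 : 0 < p < 1) (UVp : levine_stacks p U V).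

Lemma stack_cards (i : nat + nat) c :
  P (entries U V i @^-1` [set c]) = (if c then p else 1 - p)%:E.
Proof.
case/andP: p01 => p0 p1; have := UVp.1 i [set c].
rewrite /distribution /pushforward => ->.
rewrite bernoulli_probE ?(ltW p0) ?(ltW p1)// !diracE.
by rewrite !in_set1; case: c => /=; rewrite ?mule1 ?mule0 ?adde0 ?add0e.
Qed.

Let cards (s t : seq bool) (i : nat + nat) : bool :=
  match i with inl k => nth false s k | inr k => nth false t k end.

Let positions (n m : nat) : seq (nat + nat) :=
  [seq inl k | k <- iota 0 n] ++ [seq inr k | k <- iota 0 m].

Lemma prefixesE s t :
  [set x | (mkseq (fun k => U k x) (size s), mkseq (fun k => V k x) (size t)) =
           (s, t)] =
  \bigcap_(i in [set` positions (size s) (size t)])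
    entries U V i @^-1` [set cards s t i].
Proof.
apply/seteqP; split=> x /=.
  move=> [sE tE] i /=; rewrite mem_cat => /orP[] /mapP[k + ->] /=.
    by rewrite mem_iota => /andP[_ ks]; rewrite -[in RHS]sE nth_mkseq.
  by rewrite mem_iota => /andP[_ kt]; rewrite -[in RHS]tE nth_mkseq.
move=> UVx; congr (_, _); apply: (@eq_from_nth _ false); rewrite size_mkseq//.
  move=> k ks; rewrite nth_mkseq//; apply: (UVx (inl k)) => /=.
  by rewrite mem_cat map_f// mem_iota.
move=> k kt; rewrite nth_mkseq//; apply: (UVx (inr k)) => /=.
by rewrite mem_cat orbC map_f// mem_iota.
Qed.

Lemma measurable_prefixes n m st :
  measurable [set x | (mkseq (fun k => U k x) n, mkseq (fun k => V k x) m) = st].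
Proof.
case: st => s t.
have [[ns mt]|nm] := pselect (n = size s /\ m = size t).
  rewrite ns mt prefixesE; apply: fin_bigcap_measurable => [|i _].
    exact: finite_seq.
  exact: measurable_funPTI.
rewrite [X in measurable X](_ : _ = set0)//; apply/seteqP; split=> x //= [sE tE].
by apply: nm; rewrite -sE -tE !size_mkseq.
Qed.

Lemma P_prefixes s t :
  P [set x | (mkseq (fun k => U k x) (size s), mkseq (fun k => V k x) (size t)) =
             (s, t)] = (weight p s * weight p t)%:E.
Proof.
have up : uniq (positions (size s) (size t)).
  rewrite cat_uniq !map_inj_uniq ?iota_uniq ?andbT //=; try by move=> ? ? [].
  by apply/hasPn => _ /mapP[k _ ->]; apply/mapP => -[].
rewrite prefixesE.
pose J := seq_fset tt (positions (size s) (size t)).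
have -> : [set` positions (size s) (size t)] = [set` J].
  by apply/seteqP; split=> i /=; rewrite seq_fsetE.
rewrite UVp.2//.
have -> : (\prod_(i <- J) P (entries U V i @^-1` [set cards s t i]) =
  \prod_(i <- positions (size s) (size t))
    (if cards s t i then p else 1 - p)%:E)%E.
  rewrite (perm_big (positions (size s) (size t))) /=.
    by apply: eq_bigr => i _; exact: stack_cards.
  by have := seq_fset_perm tt (positions (size s) (size t)); rewrite undup_id.
have prodE (w : seq bool) : \prod_(k <- iota 0 (size w))
    (if nth false w k then p else 1 - p) = weight p w.
  rewrite -[size w]subn0 -/(index_iota _ _).
  rewrite -(big_nth false predT (fun c : bool => if c then p else 1 - p)).
  elim: w => [|c w IHw]; first by rewrite big_nil /weight !expr0 mulr1.
  by rewrite big_cons IHw /weight /=; case: c; rewrite /= exprS; ring.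
by rewrite prodEFin big_cat !big_map /= !prodE.
Qed.

(** All that is used later about the law of the stacks: the probability of an
    event about finitely many cards is a double finite sum. *)
Lemma P_finite_event n m (b : rel (seq bool)) :
  P [set x | b (mkseq (fun k => U k x) n) (mkseq (fun k => V k x) m)] =
  (expect p n (fun s => expect p m (fun t => (b s t)%:R)))%:E.
Proof.
rewrite (@measure_sum_over_values _ _ _ P _
  (fun x => (mkseq (fun k => U k x) n, mkseq (fun k => V k x) m))
  [seq (s, t) | s <- words n, t <- words m] (fun st => b st.1 st.2)).
- rewrite big_mkcond big_allpairs -sumEFin; apply: eq_big_seq => s.
  rewrite mem_words => /eqP ns.
  rewrite mulr_sumr -sumEFin; apply: eq_big_seq => t.
  rewrite mem_words => /eqP mt /=.
  case: (b s t); rewrite ?mulr1 ?mulr0 ?mul0r//.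
  by rewrite -P_prefixes ns mt.
- by apply: allpairs_uniq; rewrite ?uniq_words// => -[? ?] [? ?] _ _ [-> ->].
- by move=> x; apply: allpairs_f; rewrite mem_words size_mkseq.
- exact: measurable_prefixes.
Qed.

End stacks.

(** By induction on n, splitting on the colour of the last card, so that the
    generating cylinders suffice. *)
Lemma measurable_prefix_event (n : nat) (B : set (seq bool)) :
  measurable [set w : stack | B (mkseq w n)].
Proof.
elim: n B => [|n IHn] B.
  have [B0|nB0] := pselect (B [::]).
    by rewrite [X in measurable X](_ : _ = setT)//; apply/seteqP; split.
  by rewrite [X in measurable X](_ : _ = set0)//; apply/seteqP; split.
have mc c : measurable [set w : stack | w n = c].
  apply: sub_gen_smallest; exists n => //; exists [set c] => //.
  by rewrite setTI.
rewrite [X in measurable X](_ : _ =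
   ([set w | w n = true] `&` [set w : stack | B (rcons (mkseq w n) true)]) `|`
   ([set w | w n = false] `&` [set w : stack | B (rcons (mkseq w n) false)])).
  apply: measurableU; apply: measurableI => //.
    exact: (IHn (fun s => B (rcons s true))).
  exact: (IHn (fun s => B (rcons s false))).
apply/seteqP; split=> w /=; rewrite mkseqS.
  by case: (w n); [left|right].
by case=> [[->]|[->]].
Qed.

Lemma measurable_finite_strategy (K : seq bool -> nat) n :
  measurable_fun [set: stack] (fun w : stack => K (mkseq w n)).
Proof.
move=> _ B _; rewrite setTI.
exact: (measurable_prefix_event n (fun s => B (K s))).
Qed.

Definition finite_strategy (K : seq bool -> nat) (n : nat) : strategy :=
  mfun_Sub (mem_set (measurable_finite_strategy K n)).

(** * The strategies by blocks and their value *)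

(** If the visible block has exactly one black card, its position is named: when
    both blocks have a single black card, the players win iff the two positions
    agree.  This gives the leading term 5 p^2 of the gain.  The remaining
    clauses say which black card is preferred when there are several. *)
Definition choose_card (i j k l : nat) (s : seq bool) : nat :=
  let black := nth false s in
  if black 0%N then
    if black j then if black i && black l then l else j else 0
  else if black i then i else if black j then j else if black k then k else l.

(** The preferences of the two players differ by the exchange of 1 with 2 and of
    3 with 4. *)
Definition choiceA : seq bool -> nat := choose_card 1 2 3 4.
Definition choiceB : seq bool -> nat := choose_card 2 1 4 3.

(** After n one-coloured blocks the strategy gives up and names the next card;
    the index is thus at most 5 n, and 5 n + 1 cards are enough to play. *)
Fixpoint block_strategy (c : seq bool -> nat) (n : nat) (s : seq bool) : nat :=
  if n is m.+1 then
    if constant (take 5 s) then (5 + block_strategy c m (drop 5 s))%N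
    else c (take 5 s)
  else 0.

Lemma block_strategy_lt c n s : (forall s, c s < 5)%N ->
  (block_strategy c n s < (n * 5).+1)%N.
Proof.
move=> c5; elim: n s => // n IHn s.
rewrite [block_strategy _ _ _]/= mulSn -addnS; case: ifP => _.
  by rewrite ltn_add2l.
exact: ltn_addr.
Qed.

Lemma choiceA_lt s : (choiceA s < 5)%N.
Proof. by rewrite /choiceA /choose_card; do ![case: ifP => // _]. Qed.

Lemma choiceB_lt s : (choiceB s < 5)%N.
Proof. by rewrite /choiceB /choose_card; do ![case: ifP => // _]. Qed.

(** s is the stack of A and t that of B, so A plays according to t. *)
Definition wins (n : nat) (s t : seq bool) : bool :=
  nth false s (block_strategy choiceA n t) &&
  nth false t (block_strategy choiceB n s).

Definition decided (s t : seq bool) : bool :=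
  [&& ~~ constant s, ~~ constant t, nth false s (choiceA t)
    & nth false t (choiceB s)].

(** First blocks for which one card named in s is already known to be black,
    while the card named in t still lies in a later block. *)
Definition half_decided (s t : seq bool) : bool :=
  [&& constant s, nth false s 0 & ~~ constant t].

Section value.
Variables (R : realFieldType) (p : R).

Definition value (n : nat) : R :=
  expect p (n * 5).+1 (fun s => expect p (n * 5).+1 (fun t => (wins n s t)%:R)).

Definition gain : R :=
  expect p 5 (fun s => expect p 5 (fun t =>
    (decided s t)%:R + p * ((half_decided s t)%:R + (half_decided t s)%:R))).

Definition restart : R :=
  expect p 5 (fun s => expect p 5 (fun t => (constant s && constant t)%:R)).

Lemma constant_nth (s : seq bool) i : constant s -> (i < size s)%N ->
  nth false s i = nth false s 0.
Proof.
case: s i => [|b s] [|i] //= /all_pred1P + si.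
by move=> ->; rewrite nth_nseq ltnS in si *; rewrite ?si.
Qed.

(** The first blocks s and t decide which player moves on, and a player who
    moves on plays the strategy with one block less.  In the mixed cases the
    card named in the later blocks is independent of the choice that names it,
    hence black with probability p. *)
Lemma valueS n : value n.+1 = gain + restart * value n.
Proof.
(* Exchanging the sums draws both first blocks before all later cards. *)
have valueE : value n.+1 = expect p 5 (fun s => expect p 5 (fun t =>
   expect p (n * 5).+1 (fun s' => expect p (n * 5).+1 (fun t' =>
     (wins n.+1 (s ++ s') (t ++ t'))%:R)))).
  rewrite /value mulSn -addnS expect_cat; apply: eq_expect => s _.
  under eq_expect do rewrite expect_cat.
  exact: expectC.
rewrite {}valueE /gain /restart [_ * value _]mulrC -expectZ -expectD.
apply: eq_expect => s s5; rewrite -expectZ -expectD; apply: eq_expect => t t5.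
transitivity (expect p (n * 5).+1 (fun s' => expect p (n * 5).+1 (fun t' =>
  ((if constant t then nth false s' (block_strategy choiceA n t')
    else nth false s (choiceA t)) &&
   (if constant s then nth false t' (block_strategy choiceB n s')
    else nth false t (choiceB s)))%:R))).
  apply: eq_expect => s' _; apply: eq_expect => t' _.
  rewrite /wins [block_strategy _ n.+1 _]/= [block_strategy _ n.+1 (s ++ _)]/=.
  rewrite !take_size_cat// !drop_size_cat//.
  by do 2![case: ifP => _]; rewrite !nth_cat s5 t5 ?choiceA_lt ?choiceB_lt
    ?ltnNge ?leq_addr ?addKn.
have fresh (c : seq bool -> nat) (w : seq bool) : (forall s, c s < 5)%N ->
    expect p (n * 5).+1
      (fun t' => (nth false t' (block_strategy c n w))%:R) = p.
  by move=> c5; apply: expect_nth; exact: block_strategy_lt.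
rewrite /decided /half_decided.
case sC: (constant s); case tC: (constant t);
  rewrite /= !(andbF, mulr0, mulr1, addr0, add0r, andbT).
- by [].
- rewrite constant_nth ?s5 ?choiceA_lt//.
  case: (nth false s 0) => /=; last by rewrite !expect_cst mulr0.
  rewrite mulr1 -[RHS](expect_cst p (n * 5).+1).
  by apply: eq_expect => s' _; apply: fresh; exact: choiceB_lt.
- rewrite (constant_nth tC) ?t5 ?choiceB_lt// expectC.
  case: (nth false t 0) => /=; last first.
    under eq_expect do under eq_expect do rewrite andbF.
    by rewrite !expect_cst mulr0.
  rewrite mulr1 -[RHS](expect_cst p (n * 5).+1).
  apply: eq_expect => t' _; under eq_expect do rewrite andbT.
  by apply: fresh; exact: choiceA_lt.
- by rewrite !expect_cst.
Qed.

(** Of the 900 pairs of two-coloured blocks, 327 are won; the entry k counts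
    those with k black cards in total. *)
Lemma tally_decided : mkseq (tally 5 decided) 11 =
  [:: 0; 0; 5; 20; 51; 84; 90; 58; 19; 0; 0]%N.
Proof. by vm_compute. Qed.

Lemma gainE : gain = 5 * p ^+ 2 * (1 - p) ^+ 8 + 20 * p ^+ 3 * (1 - p) ^+ 7
  + 51 * p ^+ 4 * (1 - p) ^+ 6 + 84 * p ^+ 5 * (1 - p) ^+ 5
  + 90 * p ^+ 6 * (1 - p) ^+ 4 + 58 * p ^+ 7 * (1 - p) ^+ 3
  + 19 * p ^+ 8 * (1 - p) ^+ 2 + 2 * p * p ^+ 5 * (1 - p ^+ 5 - (1 - p) ^+ 5).
Proof.
have -> : gain = expect p 5 (fun s => expect p 5 (fun t => (decided s t)%:R)) +
   p *+ 2 * expect p 5 (fun s => expect p 5 (fun t => (half_decided s t)%:R)).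
  have sym : expect p 5 (fun s => expect p 5 (fun t => (half_decided t s)%:R)) =
    expect p 5 (fun s => expect p 5 (fun t => (half_decided s t)%:R)).
    exact: expectC.
  rewrite mulr2n mulrDl -{2}sym -!expectZ -!expectD; apply: eq_expect => s _.
  by rewrite -!expectZ -!expectD; apply: eq_expect => t _; ring.
rewrite !expect_tally tally_decided.
rewrite (_ : mkseq (tally 5 half_decided) 11 =
  [:: 0; 0; 0; 0; 0; 0; 5; 10; 10; 5; 0]%N); last by vm_compute.
rewrite !big_ord_recr !big_ord0 /=; ring.
Qed.

Lemma restartE : restart = (p ^+ 5 + (1 - p) ^+ 5) ^+ 2.
Proof.
rewrite /restart (@expect_tally _ _ _ (fun s t => constant s && constant t)).
rewrite (_ : mkseq _ _ = [:: 1; 0; 0; 0; 0; 2; 0; 0; 0; 0; 1]%N);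
  last by vm_compute.
rewrite !big_ord_recr !big_ord0 /=; ring.
Qed.

End value.

(** * From the recursion to the bound on the supremum *)

Section limit.
Variables (R : realType) (p : R).
Hypothesis p01 : 0 < p < 1.

Lemma restart_itv : 0 < restart p < 1.
Proof.
case/andP: p01 => p0 p1; rewrite restartE.
have pow5 (x : R) : 0 < x < 1 -> 0 < x ^+ 5 < x.
  move=> /andP[x0 x1]; rewrite exprn_gt0//=.
  by rewrite exprS gtr_pMr// exprn_ilt1// ltW.
have /andP[p50 p5] := pow5 _ p01.
have /andP[q50 q5] : 0 < (1 - p) ^+ 5 < 1 - p by apply: pow5; lra.
by rewrite exprn_gt0 ?addr_gt0//= exprn_ilt1//; lra.
Qed.

Lemma U3_denE : p * (10 - 45 * p + 120 * p ^+ 2 - 210 * p ^+ 3 + 250 * p ^+ 4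
    - 200 * p ^+ 5 + 100 * p ^+ 6 - 25 * p ^+ 7) = 1 - restart p.
Proof. by rewrite restartE; ring. Qed.

Lemma U3_den_gt0 : 0 < 10 - 45 * p + 120 * p ^+ 2 - 210 * p ^+ 3
    + 250 * p ^+ 4 - 200 * p ^+ 5 + 100 * p ^+ 6 - 25 * p ^+ 7.
Proof.
have /andP[_ r1] := restart_itv; case/andP: p01 => p0 _.
by rewrite -(pmulr_rgt0 _ p0) U3_denE subr_gt0.
Qed.

(** Numerator and denominator of U3 are [gain p] and 1 - [restart p], both
    divided by p. *)
Lemma U3_fixpoint : U3 p = gain p + restart p * U3 p.
Proof.
apply/eqP; rewrite -subr_eq -{1}[U3 p]mul1r -mulrBl -U3_denE; apply/eqP.
rewrite -mulrA [X in p * X]mulrC /U3 divfK ?gt_eqF ?U3_den_gt0//.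
by rewrite gainE; ring.
Qed.

(** The map x |-> gain + restart * x contracts by the factor [restart p] towards
    its fixed point U3 p, and the value at n = 0 is nonnegative. *)
Lemma value_ge n : U3 p * (1 - restart p ^+ n) <= value p n.
Proof.
have /andP[r0 r1] := restart_itv.
elim: n => [|n IHn].
  rewrite expr0 subrr mulr0.
  have p01' : 0 <= p <= 1 by case/andP: p01 => /ltW -> /ltW ->.
  by apply: expect_ge0 => // s; apply: expect_ge0 => // t; exact: ler0n.
rewrite valueS exprS mulrBr mulr1 {1}U3_fixpoint -addrA lerD2l.
rewrite -(ler_pM2l r0) in IHn; apply: le_trans IHn.
by rewrite !mulrBr mulr1 [X in _ <= _ - X]mulrCA.
Qed.

Lemma U3_limit (x : \bar R) :
  (forall n, ((value p n)%:E <= x)%E) -> ((U3 p)%:E <= x)%E.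
Proof.
move=> vx; apply/lee_addgt0Pr => e e0.
have /andP[r0 r1] := restart_itv.
have r1' : `|restart p| < 1 by rewrite gtr0_norm.
have [N _ /(_ N (leqnn N))/= small] :=
  cvgr_lt _ (cvg_geometric (U3 p) r1') _ e0.
apply: (@le_trans _ _ ((value p N)%:E + e%:E)%E); last by rewrite leeD2r.
rewrite -EFinD lee_fin; apply: le_trans (lerD (value_ge N) (lexx e)).
by rewrite mulrBr mulr1 -addrA lerDl; lra.
Qed.

End limit.

Lemma value_le_V2 (R : realType) (d : measure_display) (T : measurableType d)
    (P : probability T R) (p : R) (U V : nat -> {RV P >-> bool}) n :
  0 < p < 1 -> levine_stacks p U V -> ((value p n)%:E <= V2 U V)%E.
Proof.
move=> p01 UVp; rewrite -(P_finite_event p01 UVp).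
pose K c := finite_strategy (block_strategy c n) (n * 5).+1.
apply: ereal_sup_ubound; exists (K choiceA, K choiceB) => //.
have ltA w := block_strategy_lt n w choiceA_lt.
have ltB w := block_strategy_lt n w choiceB_lt.
congr (P _); apply/seteqP; split=> x; rewrite /wins /win /K /=.
  by move=> [Ux Vx]; rewrite !nth_mkseq ?ltA ?ltB// Ux Vx.
by rewrite !nth_mkseq ?ltA ?ltB// => /andP[].
Qed.

(** * Comparison of U3 with U1 and U2 *)

(** In powers of y = 39/125 - p, where 39/125 = 0.312, all coefficients are
    positive.  The constant one is about 0.0002: the polynomial has a root just
    beyond 0.312. *)
Lemma U1_gap_gt0 (R : realFieldType) (p : R) : p <= 312 / 1000 ->
  0 < 2 - 19 * p + 79 * p ^+ 2 - 198 * p ^+ 3 + 330 * p ^+ 4 - 372 * p ^+ 5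
      + 280 * p ^+ 6 - 128 * p ^+ 7 + 32 * p ^+ 8.
Proof.
move=> pa; have [y -> y0] : exists2 y, p = 39 / 125 - y & 0 <= y.
  by exists (39 / 125 - p); lra.
have h n : 0 <= y ^+ n by exact: exprn_ge0.
move: (h 2%N) (h 3%N) (h 4%N) (h 5%N) (h 6%N) (h 7%N) (h 8%N) => *.
lra.
Qed.

(** As before, all coefficients in powers of y = 39/125 - p are positive. *)
Lemma U2_gap_gt0 (R : realFieldType) (p : R) : p <= 312 / 1000 ->
  0 < 10 - 75 * p + 279 * p ^+ 2 - 682 * p ^+ 3 + 1194 * p ^+ 4
      - 1556 * p ^+ 5 + 1516 * p ^+ 6 - 1096 * p ^+ 7 + 568 * p ^+ 8
      - 192 * p ^+ 9 + 32 * p ^+ 10.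
Proof.
move=> pa; have [y -> y0] : exists2 y, p = 39 / 125 - y & 0 <= y.
  by exists (39 / 125 - p); lra.
have h n : 0 <= y ^+ n by exact: exprn_ge0.
move: (h 2%N) (h 3%N) (h 4%N) (h 5%N) (h 6%N) (h 7%N) (h 8%N) (h 9%N) (h 10%N) => *.
lra.
Qed.

Lemma U1_lt_U3 (R : realType) (p : R) : 0 < p <= 312 / 1000 -> U1 p < U3 p.
Proof.
move=> /andP[p0 pa].
have p01 : 0 < p < 1 by lra.
have D1 : 0 < 2 + p + p ^+ 2 + p ^+ 3 - p ^+ 4.
  have p4 : p ^+ 4 <= 1 by apply: exprn_ile1; lra.
  have := exprn_gt0 2 p0; have := exprn_gt0 3 p0; lra.
rewrite /U1 /U3 ltr_pdivrMr// mulrAC ltr_pdivlMr ?U3_den_gt0// -subr_gt0.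
set Q := (X in 0 < X).
have -> : Q = p ^+ 3 * (1 - p) ^+ 2 * (2 - 19 * p + 79 * p ^+ 2 - 198 * p ^+ 3
  + 330 * p ^+ 4 - 372 * p ^+ 5 + 280 * p ^+ 6 - 128 * p ^+ 7 + 32 * p ^+ 8).
  by rewrite /Q; ring.
by rewrite !mulr_gt0 ?exprn_gt0 ?subr_gt0 ?U1_gap_gt0//; lra.
Qed.

Lemma U2_lt_U3 (R : realType) (p : R) : 0 < p <= 312 / 1000 -> U2 p < U3 p.
Proof.
move=> /andP[p0 pa].
have p01 : 0 < p < 1 by lra.
have D2 : 0 < 4 - 2 * p - 2 * p ^+ 2 + 3 * p ^+ 3 - p ^+ 4.
  have p4 : p ^+ 4 <= 1 by apply: exprn_ile1; lra.
  have p2 : p ^+ 2 <= p by rewrite expr2 ger_pMr//; lra.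
  have := exprn_gt0 3 p0; lra.
rewrite /U2 /U3 ltr_pdivrMr// mulrAC ltr_pdivlMr ?U3_den_gt0// -subr_gt0.
set Q := (X in 0 < X).
have -> : Q = p * (1 - p) ^+ 2 * (10 - 75 * p + 279 * p ^+ 2 - 682 * p ^+ 3
  + 1194 * p ^+ 4 - 1556 * p ^+ 5 + 1516 * p ^+ 6 - 1096 * p ^+ 7
  + 568 * p ^+ 8 - 192 * p ^+ 9 + 32 * p ^+ 10).
  by rewrite /Q; ring.
by rewrite !mulr_gt0 ?exprn_gt0 ?subr_gt0 ?U2_gap_gt0//; lra.
Qed.

Theorem theorem29 (R : realType) :
  exists p0 : R, 312 / 1000 <= p0 < 313 / 1000 /\
    forall p : R, 0 < p < p0 ->
      (forall (d : measure_display) (T : measurableType d)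
         (P : probability T R) (U V : nat -> {RV P >-> bool}),
         levine_stacks p U V -> ((U3 p)%:E <= V2 U V)%E) /\
      Num.max (U1 p) (U2 p) < U3 p.
Proof.
exists (312 / 1000); split=> [|p /andP[p0 pa]]; first by lra.
have pa' : 0 < p <= 312 / 1000 by rewrite p0 ltW.
have p01 : 0 < p < 1 by lra.
split=> [d T P U V UVp|]; last by rewrite gt_max U1_lt_U3// U2_lt_U3.
by apply: U3_limit => // n; exact: value_le_V2.
Qed.
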